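(* Let $Q$ be a groupoid. Then $Q$ is a quadratical quasigroup if and only if $Q$ is bookend, medial, strongly elastic and satisfies property A.
   Context: A groupoid is a nonempty set with a binary operation, written as juxtaposition. A groupoid $G$ is right solvable if for all $a,b\in G$ there is a unique $x\in G$ with $ax=b$. It has property A if $(xy)x=(zx)(yz)$ for all $x,y,z\in G$. A quadratical groupoid (equivalently, quadratical quasigroup) is a right solvable groupoid with property A; such a groupoid is known to be a quasigroup. A groupoid is bookend if $(yx)(xy)=x$ for all $x,y$; medial if $(xy)(zw)=(xz)(yw)$ for all $x,y,z,w$; strongly elastic if $x(yx)=(xy)x=(yx)y$ for all $x,y$. *)

(* Defs.v *)
Record groupoid : Type := Groupoid {
  carrier :> Type;
  mul : carrier -> carrier -> carrier;
  carrier_inhabited : inhabited carrier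
}.

Arguments mul {g} _ _.

Declare Scope groupoid_scope.
Delimit Scope groupoid_scope with groupoid.
Notation "x * y" := (mul x y) : groupoid_scope.
Local Open Scope groupoid_scope.

Definition right_solvable (G : groupoid) : Prop :=
  forall a b : G, exists! x : G, a * x = b.

Definition property_A (G : groupoid) : Prop :=
  forall x y z : G, (x * y) * x = (z * x) * (y * z).

(* Left solvability is not required: it follows from these two conditions. *)
Definition quadratical_quasigroup (G : groupoid) : Prop :=
  right_solvable G /\ property_A G.

Definition bookend (G : groupoid) : Prop :=
  forall x y : G, (y * x) * (x * y) = x.

Definition medial (G : groupoid) : Prop :=
  forall x y z w : G, (x * y) * (z * w) = (x * z) * (y * w).

Definition strongly_elastic (G : groupoid) : Prop :=
  forall x y : G, x * (y * x) = (x * y) * x /\ (x * y) * x = (y * x) * y.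

(* Main.v *)
Require Import Defs.
From Stdlib Require Import Setoid.

(** The plane model is [x * y = p x + q y] over the complex numbers with
    [p = (1 + i) / 2] and [q = (1 - i) / 2]: the product is the apex of a right
    isosceles triangle on [x], [y], and [(x * y) * x] is the midpoint of [x]
    and [y].  Property A says that [(z * x) * (y * z)] is this same midpoint
    for every choice of the pivot [z].

    From the identities to solvability: cancellation on the left holds because,
    if [a * x = a * y], then A and bookend show that the midpoint of [x] and [y]
    is [y], and also that it is [x].
    A solution of [a * x = b] is [(b * u) * (u * a)] with [u = b * (b * a)].
    In the model with [a = 0], [b = 1], the solution must be [1 / q = 1 + i],
    and this is the value of that term.

    From solvability to the identities: cancellation, idempotence, bookend and
    strong elasticity come from choosing the pivot well ([left_cancel],
    [right_cancel], [idempotent], [bookend_of_quadratical]).  Mediality is the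
    substantial part.  Say that the arrows [a -> b] and [c -> d] are equal when
    the midpoints of [a], [d] and of [b], [c] agree ([arrow]).
    Changing the pivot from [k] to [k'] translates one
    argument of the midpoint and translates the other back, so equality of
    arrows is transitive ([arrow_trans]); midpoints being commutative,
    equality of arrows is also stable under the exchange of [b] and [c].  This
    is the calculus of vectors of an abelian group in which the midpoint halves
    sums ([arrow_half]).  It yields the splitting [u * v = u * o + o * v] around
    any origin [o] ([arrow_mul]), hence [arrow_mul2]: the arrow from [z * w] to
    [z * x] is independent of [z].  One more pivot turns this into mediality
    ([medial_of_quadratical]). *)

Local Open Scope groupoid_scope.

(** * From the identities to right solvability *)

Lemma idempotent_of_bookend (Q : groupoid) :
  bookend Q -> strongly_elastic Q -> property_A Q -> forall x : Q, x * x = x.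
Proof.
  intros HB HE HA x.
  assert (E1 : (x * x) * x = x) by (rewrite (HA x x x); apply HB).
  assert (E2 : x * (x * x) = x) by (rewrite (proj1 (HE x x)); exact E1).
  transitivity (((x * x) * x) * (x * (x * x))).
  - now rewrite E1, E2.
  - apply HB.
Qed.

(** By A with pivot [a], the midpoint of [x] and [y] is [(a * x) * (y * a)].
    If [a * x = a * y] this is [(a * y) * (y * a) = y], and by symmetry
    the midpoint is also [x]. *)
Lemma left_cancel_of_bookend (Q : groupoid) :
  bookend Q -> strongly_elastic Q -> property_A Q ->
  forall a x y : Q, a * x = a * y -> x = y.
Proof.
  intros HB HE HA a x y E.
  assert (Ey : (x * y) * x = y) by (rewrite (HA x y a), E; apply HB).
  assert (Ex : (y * x) * y = x) by (rewrite (HA y x a), <- E; apply HB).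
  rewrite <- Ey, <- Ex at 1. symmetry. apply HE.
Qed.

(** Distributing [a = a * a] over the product and swapping the middle factors
    leaves the midpoint of [a] and [b] times [u]; with [u = b * (b * a)] this is
    an instance of bookend. *)
Lemma left_division_formula (Q : groupoid) :
  bookend Q -> medial Q -> strongly_elastic Q -> property_A Q ->
  forall a b : Q,
    a * ((b * (b * (b * a))) * ((b * (b * a)) * a)) = b.
Proof.
  intros HB HM HE HA a b.
  pose proof (idempotent_of_bookend Q HB HE HA) as HI.
  assert (HD : forall x y : Q, a * (x * y) = (a * x) * (a * y)).
  { intros x y. rewrite <- (HI a) at 1. apply HM. }
  set (u := b * (b * a)).
  rewrite HD, (HD b u), (HM (a * b) (a * u) a (u * a)), HB.
  rewrite (proj2 (HE a b)). apply HB.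
Qed.

Lemma right_solvable_of_bookend (Q : groupoid) :
  bookend Q -> medial Q -> strongly_elastic Q -> property_A Q ->
  right_solvable Q.
Proof.
  intros HB HM HE HA a b.
  exists ((b * (b * (b * a))) * ((b * (b * a)) * a)). split.
  - now apply left_division_formula.
  - intros x Hx. apply (left_cancel_of_bookend Q HB HE HA a).
    rewrite Hx. now apply left_division_formula.
Qed.

(** * Quasigroup laws of a quadratical groupoid *)

Section Quadratical.

Context (Q : groupoid) (HS : right_solvable Q) (HA : property_A Q).

Implicit Types a b c d e f k m o u v w x y z : Q.

Lemma left_cancel a x y : a * x = a * y -> x = y.
Proof.
  intros E. destruct (HS a (a * y)) as [t [_ Ht]].
  rewrite <- (Ht x E). now apply Ht.
Qed.

(** Compare the pivots [x] and [y] in A for the pair [a], [a]: the left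
    factors [x * a] and [y * a] agree, so [a * x = a * y]. *)
Lemma right_cancel a x y : x * a = y * a -> x = y.
Proof.
  intros E. apply (left_cancel a), (left_cancel (y * a)).
  rewrite <- E at 1. now rewrite <- !HA.
Qed.

(** If [x * e = x], the pivot [e] in A for the pair [x], [x] gives
    [(x * x) * x = (e * x) * x], hence [e = x]. *)
Lemma idempotent x : x * x = x.
Proof.
  destruct (HS x x) as [e [He _]].
  assert (E : (e * x) * x = (x * x) * x).
  { rewrite (HA x x e). now rewrite He. }
  apply right_cancel, right_cancel in E. now rewrite E in He.
Qed.

Lemma bookend_of_quadratical : bookend Q.
Proof. intros x y. rewrite <- HA. now rewrite !idempotent. Qed.

Lemma strongly_elastic_of_quadratical : strongly_elastic Q.
Proof.
  intros x y. split.
  - now rewrite (HA x y x), idempotent.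
  - now rewrite (HA x y y), idempotent.
Qed.

(** If [b * w = a] and [a * z = w], then bookend and the choice of [z] write
    [a] both as [(z * a) * (a * z)] and as [b * (a * z)]. *)
Lemma left_solvable a b : exists z, z * a = b.
Proof.
  destruct (HS b a) as [w [Hw _]]. destruct (HS a w) as [z [Hz _]].
  exists z. apply (right_cancel (a * z)).
  rewrite bookend_of_quadratical. now rewrite Hz.
Qed.

(** * Midpoints *)

Definition mid x y : Q := (x * y) * x.

Lemma mid_pivot k x y : (k * x) * (y * k) = mid x y.
Proof. symmetry. apply HA. Qed.

Lemma mid_comm x y : mid x y = mid y x.
Proof. apply strongly_elastic_of_quadratical. Qed.

Lemma mid_idem x : mid x x = x.
Proof. unfold mid. now rewrite !idempotent. Qed.

Lemma mid_cancel x y y' : mid x y = mid x y' -> y = y'.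
Proof.
  rewrite <- !(mid_pivot x x). intros E.
  now apply left_cancel, right_cancel in E.
Qed.

Lemma mid_solvable x m : exists y, mid x y = m.
Proof.
  destruct (HS (x * x) m) as [t [Ht _]].
  destruct (left_solvable x t) as [y Hy].
  exists y. now rewrite <- (mid_pivot x), Hy.
Qed.

(** * Equality of arrows *)

(** The arrows [a -> b] and [c -> d] are equal as vectors: [a, b, d, c] is a
    parallelogram, a condition tested here on its diagonals. *)
Definition arrow a b c d : Prop := mid a d = mid b c.

Lemma arrow_sym a b c d : arrow a b c d -> arrow c d a b.
Proof.
  unfold arrow. intros E. now rewrite (mid_comm c b), (mid_comm d a).
Qed.

(** The other pair of parallel sides of the same parallelogram. *)
Lemma arrow_swap a b c d : arrow a b c d -> arrow a c b d.
Proof. unfold arrow. intros E. now rewrite (mid_comm c b). Qed.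

Lemma arrow_exists a b c : exists d, arrow a b c d.
Proof. apply mid_solvable. Qed.

Lemma arrow_unique a b c d d' : arrow a b c d -> arrow a b c d' -> d = d'.
Proof.
  unfold arrow. intros E E'. apply (mid_cancel a). now rewrite E.
Qed.

(** For fixed pivots, [k' * x' = k * x] makes [x'] a translate of [x].
    Compensating by [y'' * k' = y' * k], the pair [x], [y'] has the same midpoint
    as [x'], [y''], by A with pivots [k] and [k'].  For [x = y] this reads
    [mid y y' = mid y' y''] and forces [y'' = y]: the compensation is the inverse
    translation. *)
Lemma arrow_of_pivots k k' x x' y y' :
  k' * x' = k * x -> k' * y' = k * y -> arrow x x' y y'.
Proof.
  intros Ex Ey. destruct (left_solvable k' (y' * k)) as [y'' H].
  assert (E : y'' = y).
  { apply (mid_cancel y').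
    rewrite (mid_comm y' y), <- (mid_pivot k' y'), <- (mid_pivot k y).
    now rewrite H, Ey. }
  subst y''. unfold arrow.
  rewrite <- (mid_pivot k x), <- (mid_pivot k' x'). now rewrite H, Ex.
Qed.

(** Pivots moving [a] to [b] also move [c] to [d] and [e] to [f]. *)
Lemma arrow_trans a b c d e f :
  arrow a b c d -> arrow c d e f -> arrow a b e f.
Proof.
  intros H1 H2. destruct (left_solvable b (a * a)) as [k Hk].
  assert (Hmove : forall x y x' y',
    k * x' = a * x -> arrow x x' y y' -> k * y' = a * y).
  { intros x y x' y' E H. destruct (HS k (a * y)) as [t [Ht _]].
    rewrite <- Ht. f_equal. apply (arrow_unique x x' y); [exact H|].
    now apply (arrow_of_pivots a k). }
  pose proof (Hmove a c b d Hk H1) as Hc.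
  apply (arrow_of_pivots a k); [exact Hk|]. now apply (Hmove c e d f).
Qed.

Lemma arrow_comp a b c a' b' c' :
  arrow a b a' b' -> arrow b c b' c' -> arrow a c a' c'.
Proof.
  intros H1 H2. apply arrow_swap. apply arrow_trans with b b'.
  - now apply arrow_swap.
  - now apply arrow_swap.
Qed.

(** Starting from [a'], lay off twice the arrow from [a] to [mid a c]: the end
    point is [c'], so the intermediate point is [mid a' c']. *)
Lemma arrow_half a c a' c' :
  arrow a c a' c' -> arrow a (mid a c) a' (mid a' c').
Proof.
  intros H. set (b := mid a c).
  assert (Hb : arrow a b b c) by (unfold arrow; now rewrite mid_idem).
  destruct (arrow_exists a b a') as [b' H1].
  destruct (arrow_exists b c b') as [c'' H2].
  assert (E : c'' = c').
  { apply (arrow_unique a c a'); [now apply arrow_comp with b b' | exact H]. }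
  subst c''.
  assert (Hb' : arrow a' b' b' c').
  { apply arrow_trans with a b; [now apply arrow_sym|].
    now apply arrow_trans with b c. }
  unfold arrow in Hb'. now rewrite Hb', mid_idem.
Qed.

(** [mid x y] is the midpoint of [mid o y] and the translate [t] of that point
    by the arrow from [o] to [x]; halve that arrow. *)
Lemma arrow_mid o x y : arrow o (mid o x) (mid o y) (mid x y).
Proof.
  set (b := mid o y). destruct (arrow_exists o x b) as [t Ht].
  assert (Hb : arrow o b b y) by (unfold arrow, b; now rewrite mid_idem).
  assert (E : mid b t = mid x y).
  { rewrite mid_comm. symmetry.
    apply arrow_trans with o b; [|exact Hb].
    now apply arrow_sym, arrow_swap. }
  rewrite <- E. now apply arrow_half.
Qed.

(** * Mediality *)

(** With [u = o * x] and [v = y * o], the products [u * v], [u * o] and [o * v]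
    are the midpoints of [x], [y], of [x], [o] and of [o], [y]. *)
Lemma arrow_mul o u v : arrow o (u * o) (o * v) (u * v).
Proof.
  destruct (HS o u) as [x [<- _]]. destruct (left_solvable o v) as [y <-].
  rewrite mid_pivot.
  rewrite <- (idempotent o) at 3. rewrite mid_pivot.
  rewrite <- (idempotent o) at 3. rewrite mid_pivot.
  rewrite (mid_comm x o). apply arrow_mid.
Qed.

(** Both arrows equal the one from [w] to [w * x], by splitting around [w]. *)
Lemma arrow_mul2 w x y z : arrow (z * w) (z * x) (y * w) (y * x).
Proof.
  apply arrow_trans with w (w * x).
  - apply arrow_sym, arrow_swap, arrow_mul.
  - apply arrow_swap, arrow_mul.
Qed.

(** Multiplying [(x * y) * (z * w)] by [(y * x) * (x * y) = x] gives, with pivot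
    [x * y], the midpoint of [z * w] and [y * x]; likewise with [y] and [z]
    exchanged. *)
Lemma medial_of_quadratical : medial Q.
Proof.
  intros x y z w. apply (right_cancel x).
  transitivity (mid (z * w) (y * x)).
  - rewrite <- (mid_pivot (x * y)). now rewrite bookend_of_quadratical.
  - rewrite (arrow_mul2 w x y z), mid_comm, <- (mid_pivot (x * z)).
    now rewrite bookend_of_quadratical.
Qed.

End Quadratical.

Theorem corollary2p4 (Q : groupoid) :
  quadratical_quasigroup Q <->
  bookend Q /\ medial Q /\ strongly_elastic Q /\ property_A Q.
Proof.
  split.
  - intros [HS HA]. repeat split; try exact HA.
    + now apply bookend_of_quadratical.
    + now apply medial_of_quadratical.
    + now apply strongly_elastic_of_quadratical.
    + now apply strongly_elastic_of_quadratical.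
  - intros (HB & HM & HE & HA). split; [|exact HA].
    now apply right_solvable_of_bookend.
Qed.
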